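(* Let $\mathcal{H}$ be a nonzero real or complex Hilbert space, let $S=\mathcal{L}(\mathcal{H})$ with the involution $A\mapsto A^{*}$ (the adjoint operator), let $k\in P^{*}(\mathcal{H},S)$, let $r$ be a nonzero scalar of the ground field of $\mathcal{H}$ and consider the kernel $\tilde K:\mathcal{H}\times\mathcal{H}\to M_2(\mathbb{C})$, $$\tilde K(x,y)=\begin{pmatrix} k(rx,ry)+k(0,0) & k(rx,y)\\ k(x,ry) & k(x,y)+k(0,0)\end{pmatrix},\qquad x,y\in\mathcal{H}.$$ Then: (a) $\tilde K\in P^{*}(\mathcal{H},S,\mathbb{C}^2)\setminus P^{+,*}(\mathcal{H},S,\mathbb{C}^2)$. (b) If $k\in P^{+,*}(\mathcal{H},S)$ and $r$ is not a root of unity, then $\tilde K\in P^{+,*}_{proj}(\mathcal{H},S,\mathbb{C}^2)$.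
   Context: A kernel $K:X\times X\to M_\ell(\mathbb{C})$ is positive definite if for all finitely many distinct points $x_1,\dots,x_n\in X$ and vectors $v_1,\dots,v_n\in\mathbb{C}^\ell$ one has $\sum_{\mu,\nu=1}^n\langle K(x_\mu,x_\nu)v_\mu,v_\nu\rangle\ge 0$; it is strictly positive definite if moreover the inequality is strict whenever at least one $v_\mu$ is nonzero. For $v\in\mathbb{C}^\ell\setminus\{0\}$, the scalar valued projection of $K$ is the scalar kernel $K_v(x,y)=\langle K(x,y)v,v\rangle$. Scalar kernels are the case $\ell=1$. $\mathcal{L}(\mathcal{H})$ is the semigroup (under composition) of bounded linear operators on $\mathcal{H}$. A kernel $K:\mathcal{H}\times\mathcal{H}\to M_\ell(\mathbb{C})$ is adjointly invariant by $S$ if $K(x,Ay)=K(A^{*}x,y)$ for all $x,y\in\mathcal{H}$ and $A\in S$. $P^{*}(\mathcal{H},S,\mathbb{C}^\ell)$ (respectively $P^{+,*}(\mathcal{H},S,\mathbb{C}^\ell)$) is the set of continuous $M_\ell(\mathbb{C})$-valued kernels on $\mathcal{H}$ that are adjointly invariant by $S$ and positive definite (respectively strictly positive definite); for $\ell=1$ one writes $P^{*}(\mathcal{H},S)$ and $P^{+,*}(\mathcal{H},S)$. $P^{+,*}_{proj}(\mathcal{H},S,\mathbb{C}^\ell)$ is the set of continuous $M_\ell(\mathbb{C})$-valued kernels $K$ on $\mathcal{H}$ that are adjointly invariant by $S$ and such that $K_v$ is strictly positive definite for every $v\in\mathbb{C}^\ell\setminus\{0\}$. *)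

(* Defs.v *)
From HB Require Import structures.
From mathcomp Require Import all_boot all_order all_algebra.
From mathcomp Require Import all_classical all_reals all_analysis.
From mathcomp Require Import complex.

Set Implicit Arguments.
Unset Strict Implicit.
Unset Printing Implicit Defensive.

Import Order.TTheory GRing.Theory Num.Theory.
Import numFieldNormedType.Exports.

Local Open Scope classical_set_scope.
Local Open Scope ring_scope.

(* Naming the numClosedFieldType structure on R[i] lets the topology that the
   analysis library puts on numClosedFieldTypes be inferred: the bare type
   [complex R] does not trigger it. *)
Definition Cfield (R : realType) : numClosedFieldType := R[i].

Inductive ground := GroundR | GroundC.

Definition gfield (R : realType) (g : ground) : numFieldType :=
  match g with GroundR => R | GroundC => Cfield R end.

Definition gconj (R : realType) (g : ground) : gfield R g -> gfield R g :=
  match g return gfield R g -> gfield R g with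
  | GroundR => id
  | GroundC => Num.conj
  end.

(* The inner product is linear in its first argument. The norm of a
   normedModType over [gfield R g] takes its values in [gfield R g]. *)
Record hilbertSpace (R : realType) (g : ground) := HilbertSpace {
  carrier :> completeNormedModType (gfield R g);
  inner : {dot carrier for @gconj R g};
  normE : forall x : carrier, `|x| ^+ 2 = inner x x
}.

Section Operators.
Variables (R : realType) (g : ground) (H : hilbertSpace R g).

(* L(H); for linear maps, boundedness near 0 amounts to boundedness on the unit
   ball and to the existence of an operator bound, see [linear_boundedP]. *)
Definition bounded_linear : set (H -> H) :=
  [set A | linear A /\ bounded_near A (nbhs (0 : H))].

(* For A in L(H) there is exactly one such B, by the Riesz representation
   theorem, so the default value plays no role. *)
Definition adjoint (A : H -> H) : H -> H :=
  xget (fun=> 0)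
    [set B | bounded_linear B /\ forall x y, inner H (A x) y = inner H x (B y)].

End Operators.

Arguments bounded_linear {R g} H.

Definition cdot (R : realType) (l : nat) (u w : 'cV[Cfield R]_l) : Cfield R :=
  \sum_(i < l) u i 0 * (w i 0)^*.

Definition mxkernel (R : realType) (X : Type) (l : nat) :=
  X -> X -> 'M[Cfield R]_l.

Definition scalar_kernel (R : realType) (X : Type) (k : X -> X -> Cfield R) :
  mxkernel R X 1 := fun x y => (k x y)%:M.

Section PositiveDefinite.
Variables (R : realType) (X : Type) (l : nat).
Implicit Type K : mxkernel R X l.

Definition kernel_sum K (n : nat) (x : 'I_n -> X)
    (v : 'I_n -> 'cV[Cfield R]_l) : Cfield R :=
  \sum_(mu < n) \sum_(nu < n) cdot (K (x mu) (x nu) *m v mu) (v nu).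

(* In [Cfield R], [0 <= z] means that z is real and nonnegative. *)
Definition posdef K :=
  forall (n : nat) (x : 'I_n -> X) (v : 'I_n -> 'cV[Cfield R]_l),
    injective x -> 0 <= kernel_sum K x v.

Definition strict_posdef K :=
  posdef K /\
  forall (n : nat) (x : 'I_n -> X) (v : 'I_n -> 'cV[Cfield R]_l),
    injective x -> (exists mu, v mu != 0) -> 0 < kernel_sum K x v.

Definition scalar_proj K (v : 'cV[Cfield R]_l) : X -> X -> Cfield R :=
  fun x y => cdot (K x y *m v) v.

End PositiveDefinite.

Section Classes.
Variables (R : realType) (g : ground) (H : hilbertSpace R g).
Variables (S : set (H -> H)) (l : nat).

Definition continuous_kernel (K : mxkernel R H l) :=
  continuous (fun p : H * H => K p.1 p.2).

Definition adjointly_invariant (K : mxkernel R H l) :=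
  forall x y A, S A -> K x (A y) = K (adjoint A x) y.

Definition Pstar : set (mxkernel R H l) :=
  [set K | [/\ continuous_kernel K, adjointly_invariant K & posdef K]].

Definition Pplusstar : set (mxkernel R H l) :=
  [set K | [/\ continuous_kernel K, adjointly_invariant K & strict_posdef K]].

Definition Pplusstar_proj : set (mxkernel R H l) :=
  [set K | [/\ continuous_kernel K, adjointly_invariant K &
    forall v : 'cV[Cfield R]_l, v != 0 ->
      strict_posdef (scalar_kernel (scalar_proj K v))]].

End Classes.

Arguments Pstar {R g} H S l.
Arguments Pplusstar {R g} H S l.
Arguments Pplusstar_proj {R g} H S l.

Definition mx2 (T : Type) (a b c d : T) : 'M[T]_2 :=
  \matrix_(i < 2, j < 2)
    if i == 0 then (if j == 0 then a else b) else (if j == 0 then c else d).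

Definition Ktilde (R : realType) (g : ground) (H : hilbertSpace R g)
    (k : H -> H -> Cfield R) (r : gfield R g) : mxkernel R H 2 :=
  fun x y => mx2 (k (r *: x) (r *: y) + k 0 0) (k (r *: x) y)
                 (k x (r *: y))                (k x y + k 0 0).

(* Main.v *)
Require Import Defs.
From mathcomp Require Import all_boot all_order all_algebra.
From mathcomp Require Import all_classical all_reals all_analysis.

(** Let s be the conjugate of r. Invariance under scalings moves r across the
    arguments of k, so that Ktilde_ij(x, y) = k (phi_j x, phi_i y)
    + delta_ij k(0, 0) with phi_0 x = s x and phi_1 x = x: the quadratic form of
    Ktilde at points x_mu is that of k at the points phi_j x_mu, plus k(0, 0)
    times the squared column sums of the weights. It vanishes as soon as the
    weights lying over each point, and those in each column, sum to 0; this
    happens for suitable weights on {0, x, s x} since phi_0 x = phi_1 (s x).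
    For a projection K_v with k strictly positive definite, a null weight c
    satisfies v_0 c(z / s) + v_1 c(z) = 0 for all z; as the orbit of z <> 0
    under 1/s is infinite and c has finite support, c lives at 0, where it
    vanishes because its total mass is 0. *)

Set Implicit Arguments.
Unset Strict Implicit.
Unset Printing Implicit Defensive.

Import Order.TTheory GRing.Theory Num.Theory.
Import numFieldNormedType.Exports.
Local Open Scope classical_set_scope.
Local Open Scope ring_scope.

(** A matrix neighbourhood comes from finitely many entry neighbourhoods, and finite intersections
    stay in the filter. *)
Lemma continuous_mx (T U : topologicalType) (m n : nat)
    (f : T -> 'M[U]_(m, n)) :
  (forall i j, continuous (fun t => f t i j)) -> continuous f.
Proof.
move=> fc t A [P Pf PA].
suff h (ij : 'I_m * 'I_n) : \forall u \near t, P ij.1 ij.2 (f u ij.1 ij.2).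
  have h' := @filter_forall _ _ (fun ij u => P ij.1 ij.2 (f u ij.1 ij.2))
    _ (nbhs_filter t) h.
  by apply: filterS h' => u hu; apply: PA => i j; exact: (hu (i, j)).
by apply: fc; exact: Pf.
Qed.

(** * Adjoints of scalings *)

Section Adjoint.
Variables (R : realType) (g : ground) (H : hilbertSpace R g).
Implicit Types (A B : H -> H) (x y : H) (a : gfield R g).

Lemma gconjK : involutive (@gconj R g).
Proof. by case: g => //= z; exact: (@conjCK (Cfield R) z). Qed.

Lemma gconjX a n : gconj (a ^+ n) = gconj a ^+ n.
Proof. by case: g a => //= a; exact: (rmorphXn (@Num.conj (Cfield R))). Qed.

Lemma gconj1 : gconj 1 = 1 :> gfield R g.
Proof. by case: g => //=; exact: (rmorph1 (@Num.conj (Cfield R))). Qed.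

Lemma gconj0 : gconj 0 = 0 :> gfield R g.
Proof. by case: g => //=; exact: (rmorph0 (@Num.conj (Cfield R))). Qed.

Lemma gconj_neq0 a : a != 0 -> gconj a != 0.
Proof. by apply: contra => /eqP a0; rewrite -(gconjK a) a0 gconj0. Qed.

Lemma bounded_linearZ A a x : bounded_linear H A -> A (a *: x) = a *: A x.
Proof.
move=> [lA _]; have A0 : A 0 = 0.
  apply: (addrI (A 0)); rewrite addr0.
  by have := lA 1 0 0; rewrite scaler0 addr0 scale1r => <-.
by have := lA a x 0; rewrite !addr0 A0 addr0.
Qed.

Lemma scale_bounded_linear a : bounded_linear H ( *:%R a).
Proof.
split; first by move=> b x y; rewrite scalerDr !scalerA mulrC.
have := @linear_bounded_continuous _ H H ( *:%R a).
by move=> [_]; apply; exact: scaler_continuous.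
Qed.

Lemma innerBr x y z : inner H x (y - z) = inner H x y - inner H x z.
Proof. exact: (linearBr (inner H)). Qed.

Lemma innerZl a x y : inner H (a *: x) y = a * inner H x y.
Proof. exact: (linearZl_LR (inner H)). Qed.

Lemma innerZr a x y : inner H x (a *: y) = gconj a * inner H x y.
Proof. exact: (linearZr_LR (inner H)). Qed.

Lemma inner_inj x y : (forall z, inner H z x = inner H z y) -> x = y.
Proof.
move=> e; apply/eqP; rewrite -subr_eq0; apply: contraT.
move=> /(@neq0_dnorm_gt0 _ _ _ (inner H)).
by rewrite innerBr e subrr ltxx.
Qed.

(** [B] lies in the set that [adjoint] picks from, which rules out the default; definiteness of the
    inner product makes the pick unique. *)
Lemma adjointE A B : bounded_linear H B ->
  (forall x y, inner H (A x) y = inner H x (B y)) -> adjoint A = B.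
Proof.
move=> lB AB; rewrite /adjoint; case: xgetP => [C _ [_ AC]|/(_ B)[]//].
by apply/funext => y; apply: inner_inj => x; rewrite -AC AB.
Qed.

Lemma adjoint_scale a : adjoint ( *:%R a : H -> H) = *:%R (gconj a).
Proof.
apply: adjointE => [|x y]; first exact: scale_bounded_linear.
by rewrite innerZl innerZr /= gconjK.
Qed.

(* When no adjoint exists, [adjoint A] is the zero map. *)
Lemma adjointZ A a x : adjoint A (a *: x) = a *: adjoint A x.
Proof.
rewrite /adjoint; case: xgetP => [B _ [lB _]|_]; last by rewrite scaler0.
exact: bounded_linearZ.
Qed.

End Adjoint.

(** * Quadratic forms at possibly repeated points *)

Section Gram.
Variables (C : numClosedFieldType) (X : choiceType) (k : X -> X -> C).

(** Unlike in [posdef], points may coincide: the points phi_j x_mu need not be distinct. *)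
Definition gram (I : finType) (p : I -> X) (w : I -> C) : C :=
  \sum_i \sum_j k (p i) (p j) * (w i * (w j)^*).

(** The push-forward of the weight [w] along [p], evaluated at [z]. *)
Definition fiber_sum (I : finType) (p : I -> X) (w : I -> C) (z : X) : C :=
  \sum_(i | p i == z) w i.

Variables (I : finType) (p : I -> X).
Let s := undup (codom p).

Lemma sum_fibers (G : I -> C) :
  \sum_i G i = \sum_(z <- s) \sum_(i | p i == z) G i.
Proof.
rewrite (exchange_big_dep predT) //=; apply: eq_bigr => i _.
rewrite -big_filter (eq_filter (a2 := pred1 (p i))) => [|z]; last exact: eq_sym.
by rewrite filter_pred1_uniq ?undup_uniq ?mem_undup ?codom_f // big_seq1.
Qed.

(** Grouping indices with the same point leaves distinct points, the only ones that [posdef] speaks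
    of. *)
Lemma gram_undup (w : I -> C) :
  gram p w = gram (tnth (in_tuple s))
                  (fun a => fiber_sum p w (tnth (in_tuple s) a)).
Proof.
pose F z z' := k z z' * (fiber_sum p w z * (fiber_sum p w z')^*).
transitivity (\sum_(z <- s) \sum_(z' <- s) F z z'); last first.
  by rewrite big_tnth; apply: eq_bigr => a _; rewrite big_tnth; exact: eq_bigr.
rewrite /gram sum_fibers; apply: eq_bigr => z _.
under eq_bigr do rewrite sum_fibers.
rewrite exchange_big /=; apply: eq_bigr => z' _.
rewrite /F /fiber_sum rmorph_sum mulr_suml mulr_sumr.
apply: eq_bigr => i /eqP->; rewrite !mulr_sumr.
by apply: eq_bigr => j /eqP->.
Qed.

Lemma gram_fiber_sum0 (w : I -> C) :
  (forall z, fiber_sum p w z = 0) -> gram p w = 0.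
Proof.
move=> w0; rewrite gram_undup /gram big1 // => a _; rewrite big1 // => b _.
by rewrite w0 mul0r mulr0.
Qed.

End Gram.

Section PosdefGram.
Variables (R : realType) (X : choiceType) (k : X -> X -> Cfield R).
Local Notation C := (Cfield R).

Lemma kernel_sum_scalar n (x : 'I_n -> X) (v : 'I_n -> 'cV[C]_1) :
  kernel_sum (scalar_kernel k) x v = gram k x (fun i => v i 0 0).
Proof.
apply: eq_bigr => i _; apply: eq_bigr => j _.
by rewrite /cdot big_ord1 mul_scalar_mx mxE mulrA.
Qed.

Lemma kernel_sum_scalar_const n (x : 'I_n -> X) (w : 'I_n -> C) :
  kernel_sum (scalar_kernel k) x (fun i => const_mx (w i)) = gram k x w.
Proof.
by rewrite kernel_sum_scalar; congr gram; apply/funext => i; rewrite mxE.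
Qed.

Variables (I : finType) (p : I -> X) (w : I -> C).

Lemma gram_ge0 : posdef (scalar_kernel k) -> 0 <= gram k p w.
Proof.
move=> pd; rewrite gram_undup -kernel_sum_scalar_const; apply: pd.
by apply/tuple_uniqP; exact: undup_uniq.
Qed.

(** A nonzero fibre sum at a point of the range would make the regrouped form positive; off the
    range the fibre is empty. *)
Lemma strict_posdef_gram_eq0 z :
  strict_posdef (scalar_kernel k) -> gram k p w = 0 -> fiber_sum p w z = 0.
Proof.
move=> [_ pd]; rewrite gram_undup -kernel_sum_scalar_const => g0.
have [/tnthP[a za]|zNs] := boolP (z \in in_tuple (undup (codom p))); last first.
  rewrite /fiber_sum big_pred0 // => i; apply/negP => /eqP piz.
  by rewrite -piz mem_undup codom_f in zNs.
apply/eqP; apply: contraT => wz; rewrite -(ltxx (0 : C)) -[X in _ < X]g0.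
apply: pd; first by apply/tuple_uniqP; exact: undup_uniq.
exists a; apply: contra wz => /eqP/matrixP/(_ 0 0); rewrite !mxE -za.
by move=> /eqP.
Qed.

End PosdefGram.

Section GramDiag.
Variables (C : numClosedFieldType) (X : choiceType) (k : X -> X -> C).
Variables (m l : nat) (p : 'I_m * 'I_l -> X) (c : C) (v : 'I_m -> 'I_l -> C).

(** The Kronecker delta couples only equal components, so its terms in each column form a column sum
    times its conjugate. *)
Lemma gram_add_diag :
  \sum_(ai : 'I_m * 'I_l) \sum_(bj : 'I_m * 'I_l)
    (k (p ai) (p bj) + (bj.2 == ai.2)%:R * c)
      * (v ai.1 ai.2 * (v bj.1 bj.2)^*)
  = gram k p (fun ai => v ai.1 ai.2) + c * \sum_j `|\sum_i v i j| ^+ 2.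
Proof.
pose T (ai bj : 'I_m * 'I_l) := v ai.1 ai.2 * (v bj.1 bj.2)^*.
under eq_bigr do under eq_bigr do rewrite mulrDl.
under eq_bigr do rewrite big_split.
rewrite big_split /=; congr (_ + _).
have TE (a b : 'I_m) (i j : 'I_l) :
  (j == i)%:R * c * T (a, i) (b, j)
  = if j == i then c * (v a i * (v b i)^*) else 0.
  by case: eqP => [->|_]; rewrite ?mul1r ?mul0r.
rewrite -(pair_bigA _ (fun a i => \sum_(bj : 'I_m * 'I_l)
    (bj.2 == i)%:R * c * T (a, i) bj)) /=.
rewrite exchange_big mulr_sumr; apply: eq_bigr => i _.
rewrite normCK rmorph_sum mulr_suml mulr_sumr; apply: eq_bigr => a _.
rewrite -(pair_bigA _ (fun b j => (j == i)%:R * c * T (a, i) (b, j))) /=.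
rewrite !mulr_sumr; apply: eq_bigr => b _.
under eq_bigr do rewrite TE.
by rewrite -big_mkcond big_pred1_eq.
Qed.

End GramDiag.

Lemma ord2_eq1 (j : 'I_2) : j != 0 -> j = 1.
Proof. by case: j => [[|[|]]] //= ? _; apply/val_inj. Qed.

Section ScalarProjection.
Variables (R : realType) (X : Type) (l : nat) (K : mxkernel R X l).
Variable u : 'cV[Cfield R]_l.

(** Scalar weights on the projection amount to weight vectors along the fixed direction [u], so
    formulas for [K] itself apply. *)
Lemma kernel_sum_scalar_proj n (x : 'I_n -> X) (v : 'I_n -> 'cV[Cfield R]_1) :
  kernel_sum (scalar_kernel (scalar_proj K u)) x v
  = kernel_sum K x (fun i => v i 0 0 *: u).
Proof.
apply: eq_bigr => i _; apply: eq_bigr => j _.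
rewrite {1}/cdot big_ord1 mul_scalar_mx mxE /scalar_proj /cdot -scalemxAr.
rewrite !mulr_suml; apply: eq_bigr => a _.
by rewrite !mxE rmorphM -mulrA [RHS]mulrACA mulrC.
Qed.

End ScalarProjection.

(** * Decomposition, continuity, invariance and positivity of [Ktilde] *)

Section Ktilde.
Variables (R : realType) (g : ground) (H : hilbertSpace R g).
Variable k : H -> H -> Cfield R.
Local Notation C := (Cfield R).
Local Notation L := (bounded_linear H).

Hypothesis k_inv : adjointly_invariant L (scalar_kernel k).

Lemma kernel_adjoint A x y : L A -> k x (A y) = k (adjoint A x) y.
Proof. by move=> /(k_inv x y) /matrixP/(_ 0 0); rewrite !mxE eqxx. Qed.

Lemma kernelZr a x y : k x (a *: y) = k (gconj a *: x) y.
Proof.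
by rewrite (kernel_adjoint _ _ (scale_bounded_linear H a)) adjoint_scale.
Qed.

Variable r : gfield R g.

(** With [r] in place of its conjugate, the formula of [KtildeE] would yield the transpose of
    [Ktilde]. *)
Definition component_map (j : 'I_2) (x : H) : H :=
  if j == 0 then gconj r *: x else x.

Lemma KtildeE x y i j :
  Ktilde k r x y i j
  = k (component_map j x) (component_map i y) + (i == j)%:R * k 0 0.
Proof.
rewrite !mxE /component_map.
case: (eqVneq i 0) => [->|/ord2_eq1->];
  case: (eqVneq j 0) => [?|/ord2_eq1 ?] /=; subst; rewrite ?mul1r ?mul0r ?addr0 //.
(* Entry (0, 0): both sides reduce to [k ((r * gconj r) *: x) y]. *)
- by rewrite [in LHS]kernelZr [in RHS]kernelZr gconjK !scalerA mulrC.
- by rewrite kernelZr gconjK.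
- by rewrite kernelZr.
Qed.

Lemma kernel_sum_Ktilde n (x : 'I_n -> H) (v : 'I_n -> 'cV[C]_2) :
  kernel_sum (Ktilde k r) x v
  = gram k (fun ij : 'I_n * 'I_2 => component_map ij.2 (x ij.1))
           (fun ij => v ij.1 ij.2 0)
    + k 0 0 * \sum_j `|\sum_i v i j 0| ^+ 2.
Proof.
pose T (ai bj : 'I_n * 'I_2) := v ai.1 ai.2 0 * (v bj.1 bj.2 0)^*.
(* Matrix and dot products become one double sum over pairs (point, component), the index type of
   [gram_add_diag]. *)
transitivity (\sum_(ai : 'I_n * 'I_2) \sum_(bj : 'I_n * 'I_2)
    Ktilde k r (x ai.1) (x bj.1) bj.2 ai.2 * T ai bj).
  rewrite /kernel_sum /cdot.
  transitivity (\sum_a \sum_i \sum_(bj : 'I_n * 'I_2)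
    Ktilde k r (x a) (x bj.1) bj.2 i * T (a, i) bj).
    apply: eq_bigr => a _.
    transitivity (\sum_(bj : 'I_n * 'I_2) \sum_i
      Ktilde k r (x a) (x bj.1) bj.2 i * T (a, i) bj); last exact: exchange_big.
    rewrite -(pair_bigA _ (fun b j => \sum_i
      Ktilde k r (x a) (x b) j i * T (a, i) (b, j))) /=.
    apply: eq_bigr => b _; apply: eq_bigr => j _.
    rewrite mxE mulr_suml; apply: eq_bigr => i _.
    by rewrite /T mulrA.
  exact: (pair_bigA _ (fun a i => \sum_(bj : 'I_n * 'I_2)
    Ktilde k r (x a) (x bj.1) bj.2 i * T (a, i) bj)).
rewrite -(gram_add_diag k (fun ai => component_map ai.2 (x ai.1)) (k 0 0)
  (fun a i => v a i 0)).
by apply: eq_bigr => ai _; apply: eq_bigr => bj _; rewrite KtildeE.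
Qed.

Lemma continuous_Ktilde :
  continuous_kernel (scalar_kernel k) -> continuous_kernel (Ktilde k r).
Proof.
move=> kc; have kc' : continuous (fun p : H * H => k p.1 p.2).
  have -> : (fun p : H * H => k p.1 p.2) =
    (fun M : 'M[C]_1 => M 0 0) \o (fun p : H * H => scalar_kernel k p.1 p.2).
    by apply/funext => p /=; rewrite mxE eqxx.
  move=> p; apply: continuous_comp; [exact: kc|exact: coord_continuous].
have kcZ a b : continuous (fun p : H * H => k (a *: p.1) (b *: p.2)).
  move=> p; apply: (@continuous_comp _ _ _
    (fun p : H * H => (a *: p.1, b *: p.2)) (fun p => k p.1 p.2)).
    by apply: cvg_pair => /=; apply: cvgZr; [exact: cvg_fst|exact: cvg_snd].
  exact: kc'.
apply: continuous_mx => i j.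
(* Both component maps are scalings, so [kcZ] covers all entries. *)
pose c (j : 'I_2) := if j == 0 then gconj r else 1.
have -> : (fun p : H * H => Ktilde k r p.1 p.2 i j) =
  (fun p => k (c j *: p.1) (c i *: p.2) + (i == j)%:R * k 0 0).
  apply/funext => p; rewrite KtildeE /component_map /c.
  by congr (k _ _ + _); case: ifP; rewrite // scale1r.
by move=> p; apply: cvgD; [exact: kcZ|exact: cvg_cst].
Qed.

(** [A] and its adjoint are homogeneous, hence commute with both component maps. *)
Lemma adjointly_invariant_Ktilde : adjointly_invariant L (Ktilde k r).
Proof.
move=> x y A LA; apply/matrixP => i j; rewrite !KtildeE; congr (_ + _).
have <- : A (component_map i y) = component_map i (A y).
  by rewrite /component_map; case: ifP; rewrite // bounded_linearZ.
have -> : component_map j (adjoint A x) = adjoint A (component_map j x).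
  by rewrite /component_map; case: ifP; rewrite // adjointZ.
exact: kernel_adjoint.
Qed.

Hypothesis k_pd : posdef (scalar_kernel k).

Lemma kernel00_ge0 : 0 <= k 0 0.
Proof.
have := gram_ge0 (fun=> 0 : H) (fun=> 1) k_pd (I := 'I_1).
by rewrite /gram !big_ord1 rmorph1 !mulr1.
Qed.

Lemma normsum_ge0 n (v : 'I_n -> 'cV[C]_2) :
  0 <= k 0 0 * \sum_j `|\sum_i v i j 0| ^+ 2.
Proof.
by rewrite mulr_ge0 ?kernel00_ge0 ?sumr_ge0 // => j _; rewrite exprn_ge0.
Qed.

Lemma posdef_Ktilde : posdef (Ktilde k r).
Proof.
move=> n x v _; rewrite kernel_sum_Ktilde.
by rewrite addr_ge0 ?normsum_ge0 ?gram_ge0.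
Qed.

End Ktilde.

(** * Infinite orbits and cancelling weights *)

Lemma orbit_notin (F : fieldType) (V : lmodType F) (y : V) (a : F) (t : seq V) :
  a != 0 -> (forall n, (0 < n)%N -> ~~ n.-unity_root a) -> y != 0 ->
  exists n, a ^- n *: y \notin t.
Proof.
move=> a0 aNU y0; apply: contrapT => h.
have sub n : a ^- n *: y \in t.
  by apply/negP => /negP nt; apply: h; exists n.
have inj : injective (fun n => a ^- n *: y).
  suff lt m n : (m < n)%N -> a ^- m *: y != a ^- n *: y.
    move=> m n e; apply/eqP; apply: contraT; rewrite neq_ltn.
    by move=> /orP[/lt|/lt]; rewrite e eqxx.
  move=> mn; rewrite -subr_eq0 -scalerBl scaler_eq0 negb_or y0 andbT subr_eq0.
  (* Equal powers would make [a] an (n - m)-th root of unity. *)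
  apply: contra (aNU (n - m)%N _) => [/eqP e|]; last by rewrite subn_gt0.
  apply/unity_rootP; rewrite expfB // -[X in X / _]invrK -e invrK.
  by rewrite divff // expf_neq0.
(* Pigeonhole: one more orbit point than [t] can hold. *)
pose orbit := [seq a ^- n *: y | n <- iota 0 (size t).+1].
have orbit_uniq : uniq orbit by rewrite map_inj_uniq ?iota_uniq.
have := uniq_leq_size orbit_uniq (s2 := t).
rewrite size_map size_iota ltnn => le; apply/notF/le => _ /mapP[n _ ->].
exact: sub.
Qed.

Lemma fiber_sum_pair (C : numClosedFieldType) (X : choiceType) (m l : nat)
    (p : 'I_m * 'I_l -> X) (w : 'I_m -> 'I_l -> C) z :
  fiber_sum p (fun ij => w ij.1 ij.2) z
  = \sum_i \sum_j if p (i, j) == z then w i j else 0.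
Proof.
rewrite /fiber_sum big_mkcond.
rewrite (pair_bigA _ (fun i j => if p (i, j) == z then w i j else 0)).
by apply: eq_bigr => -[].
Qed.

Lemma fiber_sum_pair2 (C : numClosedFieldType) (X : choiceType) (m : nat)
    (p : 'I_m * 'I_2 -> X) (w : 'I_m -> 'I_2 -> C) z :
  fiber_sum p (fun ij => w ij.1 ij.2) z
  = fiber_sum (fun i => p (i, 0)) (w^~ 0) z
    + fiber_sum (fun i => p (i, 1)) (w^~ 1) z.
Proof.
rewrite fiber_sum_pair exchange_big big_ord_recl big_ord1 /=.
have -> : lift ord0 ord0 = 1 :> 'I_2 by apply/val_inj.
by rewrite /fiber_sum -!big_mkcond.
Qed.

Section CancellingWeights.
Variables (V : pzRingType) (n : nat) (i0 i1 i2 : 'I_n).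

(* Two cancelling couples, (i1, 0) against (i2, 1) and (i0, 1) against (i0, 0);
   the second one brings the total weight of each column back to 0. *)
Definition cancelling_weight (i : 'I_n) (j : 'I_2) : V :=
  if j == 0 then (i == i1)%:R - (i == i0)%:R else (i == i0)%:R - (i == i2)%:R.

Lemma sum_cancelling_weight j : \sum_i cancelling_weight i j = 0.
Proof.
have delta (a : 'I_n) : \sum_i (i == a)%:R = 1 :> V.
  by rewrite (bigD1 a) //= eqxx big1 ?addr0 // => i /negPf->.
by rewrite /cancelling_weight; case: (j == 0); rewrite sumrB !delta subrr.
Qed.

(** The two hypotheses put both terms of each couple over the same point. *)
Lemma sum_cancelling_weight_fiber (X : eqType) (q : 'I_n -> 'I_2 -> X) z :
  q i0 0 = q i0 1 -> q i1 0 = q i2 1 ->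
  \sum_i \sum_j (if q i j == z then cancelling_weight i j else 0) = 0.
Proof.
move=> q0 q12.
have delta a j : \sum_i (q i j == z)%:R * (i == a)%:R = (q a j == z)%:R :> V.
  rewrite (bigD1 a) //= eqxx mulr1 big1 ?addr0 // => i /negPf->.
  by rewrite mulr0.
have ifE (b : bool) (t : V) : (if b then t else 0) = b%:R * t.
  by case: b; rewrite ?mul1r ?mul0r.
rewrite exchange_big big_ord_recl big_ord1 /=.
have -> : lift ord0 ord0 = 1 :> 'I_2 by apply/val_inj.
rewrite /cancelling_weight /=.
under eq_bigr do rewrite ifE mulrBr.
under [X in _ + X]eq_bigr do rewrite ifE mulrBr.
by rewrite !sumrB !delta q0 q12 addrA subrK subrr.
Qed.

Lemma cancelling_weight1 : i0 != i1 -> cancelling_weight i1 0 = 1.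
Proof.
by move=> i01; rewrite /cancelling_weight !eqxx eq_sym (negPf i01) subr0.
Qed.

End CancellingWeights.

(** * Strictness: failure for [Ktilde], validity for its projections *)

Section Strictness.
Variables (R : realType) (g : ground) (H : hilbertSpace R g).
Variable k : H -> H -> Cfield R.
Local Notation C := (Cfield R).
Local Notation L := (bounded_linear H).

Hypothesis k_inv : adjointly_invariant L (scalar_kernel k).

Variable r : gfield R g.

(** The indices stay abstract because [i1] and [i2] coincide when s x = x. *)
Lemma not_strict_posdef_Ktilde_points (n : nat) (x : 'I_n -> H)
    (i0 i1 i2 : 'I_n) :
  injective x -> i0 != i1 ->
  component_map r 0 (x i0) = component_map r 1 (x i0) ->
  component_map r 0 (x i1) = component_map r 1 (x i2) ->
  ~ strict_posdef (Ktilde k r).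
Proof.
move=> xI i01 q0 q12 [_ pd].
pose w : 'I_n -> 'I_2 -> C := cancelling_weight C i0 i1 i2.
have vE (a : 'I_n) (b : 'I_2) : (\col_c w a c) b 0 = w a b by rewrite mxE.
have /(pd n x (fun i => \col_c w i c) xI) : exists i, \col_c w i c != 0.
  exists i1; apply/eqP => /matrixP/(_ 0 0).
  by rewrite vE mxE /w cancelling_weight1 // => /eqP; rewrite oner_eq0.
rewrite kernel_sum_Ktilde // gram_fiber_sum0 => [|z].
  rewrite add0r big1 ?mulr0 ?ltxx // => b _.
  under eq_bigr do rewrite vE.
  by rewrite sum_cancelling_weight normr0 expr0n.
rewrite (fiber_sum_pair _ (fun a b => (\col_c w a c) b 0)).
rewrite -[RHS](@sum_cancelling_weight_fiber C _ _ _ _ _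
  (fun i j => component_map r j (x i)) z q0 q12).
by apply: eq_bigr => a _; apply: eq_bigr => b _; rewrite vE.
Qed.

Lemma not_strict_posdef_Ktilde :
  r != 0 -> (exists x : H, x != 0) -> ~ strict_posdef (Ktilde k r).
Proof.
move=> r0 [x x0]; pose s := gconj r.
have s0 : s != 0 by exact: gconj_neq0.
have sx0 : s *: x != 0 by rewrite scaler_eq0 negb_or s0.
(* The origin, fixed by both component maps, takes the index [i0]; if s x = x, the point x serves
   for both [i1] and [i2]. *)
have [s1|s1] := eqVneq (s *: x) x.
  have xI : injective (tnth [tuple 0; x]).
    by apply/tuple_uniqP; rewrite /= inE eq_sym x0.
  apply: (not_strict_posdef_Ktilde_points
      (i0 := 0) (i1 := 1) (i2 := 1) xI) => //.
    exact: scaler0.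
have xI : injective (tnth [tuple 0; x; s *: x]).
  by apply/tuple_uniqP; rewrite /= !inE negb_or !(eq_sym 0) x0 sx0 eq_sym s1.
apply: (not_strict_posdef_Ktilde_points
  (i0 := 0) (i1 := 1) (i2 := ord_max) xI) => //.
exact: scaler0.
Qed.

Lemma strict_posdef_scalar_proj (u : 'cV[C]_2) :
  strict_posdef (scalar_kernel k) -> r != 0 ->
  (forall n, (0 < n)%N -> ~~ n.-unity_root r) -> u != 0 ->
  strict_posdef (scalar_kernel (scalar_proj (Ktilde k r) u)).
Proof.
move=> kst r0 rNU u0; have [kpd _] := kst; set s := gconj r.
have s0 : s != 0 by exact: gconj_neq0.
have sNU n : (0 < n)%N -> ~~ n.-unity_root s.
  move=> /rNU; apply: contra => /unity_rootP sn1; apply/unity_rootP.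
  by rewrite -(gconjK r) -/s -gconjX sn1 gconj1.
split=> [n x v xI|n x v xI [i vi]]; rewrite kernel_sum_scalar_proj.
  exact: posdef_Ktilde.
rewrite lt_def posdef_Ktilde // andbT kernel_sum_Ktilde //.
apply: contra vi; rewrite paddr_eq0 ?gram_ge0 ?normsum_ge0 //.
set w := fun i => v i 0 0.
move=> /andP[/eqP g0 sum0].
(* Strictness at the single point 0 with weight 1. *)
have k00 : k 0 0 != 0.
  have : 0 < kernel_sum (scalar_kernel k) (fun _ : 'I_1 => 0 : H)
                        (fun=> const_mx 1).
    apply: kst.2 => [a b _|]; first by rewrite !ord1.
    exists 0; apply/eqP => /matrixP/(_ 0 0).
    by rewrite !mxE => /eqP; rewrite oner_eq0.
  rewrite kernel_sum_scalar_const /gram !big_ord1 rmorph1 !mulr1.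
  by move=> /gt_eqF->.
(* Column j sums to the total mass of [w] times [u j 0]; a nonzero coordinate of [u] can be
   cancelled. *)
have {sum0} w0 : \sum_i w i = 0.
  move: sum0; rewrite mulf_eq0 (negPf k00) /= psumr_eq0; last first.
    by move=> j _; rewrite exprn_ge0.
  move=> /allP sum0.
  have [j uj] : exists j, u j 0 != 0.
    apply: contrapT => h; move/eqP: u0; apply; apply/matrixP => j c.
    by rewrite ord1 mxE; apply/eqP; apply: contraT => uj; case: h; exists j.
  have uE : \sum_i (v i 0 0 *: u) j 0 = (\sum_i w i) * u j 0.
    by rewrite mulr_suml; apply: eq_bigr => b _; rewrite mxE.
  have /implyP/(_ isT) := sum0 j (mem_index_enum j).
  by rewrite expf_eq0 normr_eq0 uE mulf_eq0 (negPf uj) orbF => /eqP.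
(* The weight becomes a function on [H], supported in the points [x i]. *)
pose c z := fiber_sum x w z.
have cx j : c (x j) = w j.
  rewrite /c /fiber_sum (eq_bigl (pred1 j)) ?big_pred1_eq // => l /=.
  exact: inj_eq.
(* Component 0 reaches [z] from [s^-1 *: z], component 1 from [z] itself. *)
have cE z : c (s^-1 *: z) * u 0 0 + c z * u 1 0 = 0.
  rewrite -[RHS](strict_posdef_gram_eq0 z kst g0).
  rewrite (fiber_sum_pair2 _ (fun a b => (v a 0 0 *: u) b 0)).
  rewrite /c /fiber_sum !mulr_suml.
  congr (_ + _); apply: eq_big => [a|a _]; rewrite ?mxE //.
  rewrite /component_map /= -/s; apply/eqP/eqP => [->|<-].
    by rewrite scalerA divff // scale1r.
  by rewrite scalerA mulVf // scale1r.
(* If [u 1 0] vanishes, the relation at [s *: z] suffices; otherwise a nonzero [c z] propagates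
   along the orbit of [z], which leaves the support. *)
have c0 z : z != 0 -> c z = 0.
  move=> z0; have [u1|u1] := eqVneq (u 1 0) 0.
    have u00 : u 0 0 != 0.
      apply: contra u0 => /eqP u00; apply/eqP/matrixP => j l; rewrite ord1 mxE.
      by case: (eqVneq j 0) => [->|/ord2_eq1->].
    have := cE (s *: z); rewrite u1 mulr0 addr0 scalerA mulVf // scale1r.
    by move=> /eqP; rewrite mulf_eq0 (negPf u00) orbF => /eqP.
  apply/eqP; apply: contraT => cz.
  have cN d : c (s ^- d *: z) != 0.
    elim: d => [|d]; first by rewrite expr0 invr1 scale1r.
    apply: contra => /eqP e; have := cE (s ^- d *: z).
    rewrite scalerA -invfM -exprS e mul0r add0r => /eqP.
    by rewrite mulf_eq0 (negPf u1) orbF.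
  have [d dx] := orbit_notin (codom x) s0 sNU z0.
  have := cN d; rewrite /c /fiber_sum big_pred0 ?eqxx // => j.
  by apply: contraNF dx => /eqP<-; rewrite codom_f.
apply/eqP/matrixP => a b; rewrite !ord1 mxE -/(w i).
(* All weights away from 0 vanish, so a weight at 0 equals the total mass. *)
have [xi0|xi0] := eqVneq (x i) 0; last by rewrite -cx c0.
rewrite -[RHS]w0 (bigD1 i isT) big1 => [|j ji]; first exact/esym/addr0.
rewrite -cx c0 //.
by apply: contra ji; rewrite -xi0 => /eqP/xI->.
Qed.

End Strictness.

Theorem mainTheorem3 (R : realType) (g : ground) (H : hilbertSpace R g)
    (H_neq0 : exists x : H, x != 0)
    (k : H -> H -> Cfield R)
    (k_Pstar : Pstar H (bounded_linear H) 1 (scalar_kernel k))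
    (r : gfield R g) (r_neq0 : r != 0) :
  (Pstar H (bounded_linear H) 2 `\` Pplusstar H (bounded_linear H) 2)
    (Ktilde k r) /\
  (Pplusstar H (bounded_linear H) 1 (scalar_kernel k) ->
   (forall n : nat, (0 < n)%N -> ~~ n.-unity_root r) ->
   Pplusstar_proj H (bounded_linear H) 2 (Ktilde k r)).
Proof.
have [kc ki kp] := k_Pstar.
have Kc := continuous_Ktilde ki (r := r) kc.
have Ki := adjointly_invariant_Ktilde ki r.
split.
  split; first by split=> //; exact: posdef_Ktilde.
  by move=> [_ _]; exact: not_strict_posdef_Ktilde.
move=> [_ _ kst] rNU; split=> // u u0.
exact: strict_posdef_scalar_proj.
Qed.
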